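(* If $f$ is a rational Schur function on $\mathbb{H}^d$, then the non-tangential limit $f^*(x)$ exists at every point $x\in\mathbb{R}^d$.
   Context: $\mathbb{H}$ is the open upper half plane. A rational Schur function on $\mathbb{H}^d$ is a rational function $f=q/p$ ($p,q\in\mathbb{C}[z_1,\dots,z_d]$, $p$ with no zeros in $\mathbb{H}^d$) which is analytic on $\mathbb{H}^d$ with $|f|\le1$ there. For $x\in\mathbb{R}^d$ and $c\ge1$, let $AR_c(x)$ be the set of $z\in\mathbb{H}^d$ such that $1/c\le a/b\le c$ for all $a,b\in\{|z_1-x_1|,\dots,|z_d-x_d|,\operatorname{Im}z_1,\dots,\operatorname{Im}z_d\}$. The non-tangential limit $f^*(x)$ exists if there is $\omega\in\mathbb{C}$ such that for every $c\ge1$ (for which $AR_c(x)$ is nonempty) $f(z)\to\omega$ as $z\to x$ with $z\in AR_c(x)$; then $f^*(x)=\omega$. *)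

(* Defs.v *)
From mathcomp Require Import all_boot all_order all_algebra.
From mathcomp Require Import all_classical all_reals all_analysis.
From mathcomp Require Import complex.
(* Not imported: the notations of mpoly clash with those of mathcomp-analysis. *)
From mathcomp Require mpoly.

Set Implicit Arguments.
Unset Strict Implicit.
Unset Printing Implicit Defensive.

Import Order.TTheory GRing.Theory Num.Theory.
Import numFieldNormedType.Exports.

Local Open Scope classical_set_scope.
Local Open Scope ring_scope.
Local Open Scope complex_scope.

(* R[i] does not itself carry a topology in the library; packaged as a
   numClosedFieldType it gets the one induced by the modulus, and
   'rV[Cplx R]_d the sup norm. *)
Definition Cplx (R : realType) : numClosedFieldType := R[i].

Definition upper_polyhalfplane (R : realType) (d : nat) :
    set 'rV[Cplx R]_d :=
  [set z : 'rV[Cplx R]_d | forall j, 0 < complex.Im (z 0 j)].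

Definition of_real_point (R : realType) (d : nat) (x : 'rV[R]_d) :
    'rV[Cplx R]_d :=
  \row_j (x 0 j)%:C.

(* [differentiable] is Frechet differentiability over the scalar field Cplx R,
   i.e. complex differentiability; on the open set H^d this is analyticity. *)
Definition analytic_on_polyhalfplane (R : realType) (d : nat)
    (f : 'rV[Cplx R]_d -> Cplx R) : Prop :=
  forall z, upper_polyhalfplane z -> differentiable f z.

(* f is a total function, but only its values on H^d are constrained. *)
Definition rational_schur (R : realType) (d : nat)
    (f : 'rV[Cplx R]_d -> Cplx R) : Prop :=
  [/\ exists p q : mpoly.mpoly d (Cplx R),
        forall z, upper_polyhalfplane z ->
          mpoly.meval (fun j => z 0 j) p != 0 /\
          f z = mpoly.meval (fun j => z 0 j) q
                / mpoly.meval (fun j => z 0 j) p,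
      analytic_on_polyhalfplane f
    & forall z, upper_polyhalfplane z -> `|f z| <= 1].

Definition AR_lengths (R : realType) (d : nat) (x : 'rV[R]_d)
    (z : 'rV[Cplx R]_d) : set R :=
  [set Normc.normc (z 0 j - (x 0 j)%:C) | j in [set: 'I_d]] `|`
  [set complex.Im (z 0 j) | j in [set: 'I_d]].

Definition AR (R : realType) (d : nat) (c : R) (x : 'rV[R]_d) :
    set 'rV[Cplx R]_d :=
  [set z : 'rV[Cplx R]_d | upper_polyhalfplane z /\
     forall a b : R, AR_lengths x z a -> AR_lengths x z b ->
       1 / c <= a / b <= c].

Definition is_nontangential_limit (R : realType) (d : nat)
    (f : 'rV[Cplx R]_d -> Cplx R) (x : 'rV[R]_d) (w : Cplx R) : Prop :=
  forall c : R, 1 <= c -> AR c x !=set0 ->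
    f z @[z --> within (AR c x) (nbhs (of_real_point x))] --> w.

(* Main.v *)
(** Near x write p(x + tv) = sum_j t^j P_j(v) with P_j homogeneous of degree j,
    similarly q with Q_j, and let M be the least j with P_j <> 0. A polynomial
    without zeros in a disc satisfies an elementary Harnack inequality there,
    read off from its linear factors. Applied to p it shows that P_M has no
    zero on H^d and that |p(x + tv)| >= const t^M for v in a truncated cone.
    From |q| <= |p| one gets Q_j = 0 for j < M and |Q_M| <= |P_M| on H^d.

    The quotient Q_M / P_M is constant: for real a > 0 and real b, almost every
    point of the complex line s |-> ia + sb is a complex multiple of a point of
    H^d, so |Q_M| <= |P_M| on the line and Q_M, P_M are proportional there;
    together with invariance under multiplication by 1 + i this links any point
    of H^d to (i, ..., i). If w is the constant, q - w p is O(t^(M+1)) while p is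
    at least of order t^M, hence f - w = O(t) on the cone. *)

Require Import Defs.
From mathcomp Require Import all_boot all_order all_algebra.
From mathcomp Require Import all_classical all_reals all_analysis.
From mathcomp Require Import complex.
From mathcomp Require Import ring lra.
From mathcomp Require mpoly.

Set Implicit Arguments.
Unset Strict Implicit.
Unset Printing Implicit Defensive.

Import Order.TTheory GRing.Theory Num.Theory.
Import numFieldNormedType.Exports.

Local Open Scope classical_set_scope.
Local Open Scope ring_scope.

(** * Univariate polynomials: Harnack inequality, domination, order of vanishing at [0] *)

Section UnivariatePolynomials.
Variable K : numClosedFieldType.
Implicit Types (A B : {poly K}) (c s t : K).

(* Each linear factor satisfies [|s - r| <= |r| (1 + |s| / delta)], because
   [delta <= |r|]. *)
Lemma harnack_poly A (n : nat) (delta : K) : (size A <= n)%N -> 0 < delta ->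
  (forall s, `|s| < delta -> A.[s] != 0) ->
  forall s, `|A.[s]| <= `|A.[0]| * (1 + `|s| / delta) ^+ n.
Proof.
move=> sA delta_gt0 A_neq0 s.
have ratio_ge0 : 0 <= `|s| / delta by rewrite divr_ge0 // ltW.
have A0 : A != 0.
  by apply/eqP => A0; have := A_neq0 0; rewrite normr0 A0 horner0 eqxx => /(_ delta_gt0).
have [r Ar] := closed_field_poly_normal A.
have size_r : (size r <= n)%N.
  apply: leq_trans sA; rewrite Ar size_scale ?lead_coef_eq0 //.
  by rewrite size_prod_XsubC.
have r_ge z : z \in r -> delta <= `|z|.
  move=> zr; rewrite real_leNgt ?normr_real ?gtr0_real //; apply/negP => /A_neq0.
  move=> /negP; apply; rewrite -/(root A z) Ar rootZ ?lead_coef_eq0 //.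
  by rewrite root_prod_XsubC.
have {r_ge} prod_le : `|(\prod_(z <- r) ('X - z%:P)).[s]| <=
    `|(\prod_(z <- r) ('X - z%:P)).[0]| * (1 + `|s| / delta) ^+ size r.
  elim: r {Ar size_r} r_ge => [|z r IHr] r_ge.
    by rewrite !big_nil !hornerC expr0 mulr1.
  rewrite !big_cons !hornerM !normrM exprS mulrACA; apply: ler_pM => //.
    rewrite !hornerXsubC sub0r normrN mulrDr mulr1 [leRHS]addrC.
    apply: le_trans (ler_normB _ _) _; rewrite lerD2r mulrCA ler_peMr //.
    by rewrite ler_pdivlMr // mul1r r_ge ?mem_head.
  by apply: IHr => y yr; apply: r_ge; rewrite in_cons yr orbT.
rewrite {1 2}Ar !hornerZ !normrM -mulrA ler_wpM2l //.
apply: le_trans prod_le _; rewrite ler_wpM2l // ler_weXn2l // lerDl //.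
Qed.

Lemma poly_bounded_unit_disc A :
  exists2 S, 0 <= S & forall t, `|t| <= 1 -> `|A.[t]| <= S.
Proof.
exists (\sum_(i < size A) `|A`_i|); first by apply: sumr_ge0.
move=> t t_le1; rewrite horner_coef; apply: le_trans (ler_norm_sum _ _ _) _.
apply: ler_sum => i _; rewrite normrM normrX ler_piMr // exprn_ile1 //.
Qed.

Lemma poly_lipschitz0 A :
  exists2 S, 0 <= S & forall t, `|t| <= 1 -> `|A.[t] - A.[0]| <= `|t| * S.
Proof.
elim/poly_ind: A => [|A a _]; first by exists 0 => // t _; rewrite !horner0 subrr normr0 mulr0.
have [S S_ge0 AS] := poly_bounded_unit_disc A; exists S => // t t_le1.
rewrite !hornerMXaddC mulr0 add0r addrK normrM mulrC ler_wpM2l //.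
exact: AS.
Qed.

(** The limit [t -> 0+] in algebraic form: Lipschitz bounds at [0] replace continuity. *)
Lemma poly_dominated_at0 A B c : 0 <= c ->
  (forall t, 0 < t < 1 -> `|A.[t]| <= c * `|B.[t]|) ->
  `|A.[0]| <= c * `|B.[0]|.
Proof.
move=> c_ge0 AB.
have [S S_ge0 AS] := poly_lipschitz0 A; have [T T_ge0 BT] := poly_lipschitz0 B.
rewrite real_leNgt ?ger0_real ?mulr_ge0 //; apply/negP; rewrite -subr_gt0.
set e := _ - _ => e_gt0.
have den_gt0 : 0 < 1 + e + (S + c * T).
  by apply: ltr_wpDr; [rewrite addr_ge0 // mulr_ge0 | exact: addr_gt0].
(* With [L = S + c * T], this [t] is below [1] and [t * L < e], whereas domination at [t] forces
   [e <= t * L]. *)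
pose t := e / (1 + e + (S + c * T)).
have t_gt0 : 0 < t by rewrite divr_gt0.
have t_lt1 : t < 1.
  rewrite ltr_pdivrMr // mul1r -addrA addrCA ltrDl ltr_pwDl //.
  by rewrite addr_ge0 // mulr_ge0.
have nt : `|t| = t by rewrite gtr0_norm.
have := AB t; rewrite t_gt0 t_lt1 => /(_ isT) ABt.
have : e <= t * (S + c * T).
  rewrite /e lerBlDr mulrDr mulrCA.
  have -> : A.[0] = A.[t] - (A.[t] - A.[0]) by rewrite opprB addrC subrK.
  apply: le_trans (ler_normB _ _) _.
  rewrite [leRHS]addrAC -addrA [leRHS]addrC; apply: lerD; last first.
    by rewrite -{2}nt AS // nt ltW.
  apply: le_trans ABt _; rewrite -mulrDr ler_wpM2l //.
  have {1}-> : B.[t] = (B.[t] - B.[0]) + B.[0] by rewrite subrK.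
  apply: le_trans (ler_normD _ _) _; rewrite addrC lerD2l -{2}nt.
  by apply: BT; rewrite nt ltW.
have ST_ge0 : 0 <= S + c * T by rewrite addr_ge0 // mulr_ge0.
rewrite /t mulrAC ler_pdivlMr // ler_pM2l // => den_le.
suff /lt_le_trans/(_ den_le) : S + c * T < 1 + e + (S + c * T) by rewrite ltxx.
by rewrite ltrDr addr_gt0.
Qed.

Lemma poly_dominated_at A B s :
  (forall t, 0 < t < 1 -> `|A.[s + t]| <= `|B.[s + t]|) -> `|A.[s]| <= `|B.[s]|.
Proof.
have shift (D : {poly K}) t : (D \Po (s%:P + 'X)).[t] = D.[s + t].
  by rewrite horner_comp !hornerE.
move=> AB; have := @poly_dominated_at0 (A \Po (s%:P + 'X)) (B \Po (s%:P + 'X)) 1 ler01.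
rewrite !shift addr0 mul1r; apply => t t01; rewrite !shift mul1r.
exact: AB.
Qed.

Lemma poly_low_coef0 A (m : nat) :
  (forall i, (i < m)%N -> A`_i = 0) -> A = drop_poly m A * 'X^m.
Proof.
move=> A0; rewrite -{1}[A](poly_take_drop m) [take_poly m A](_ : _ = 0) ?add0r //.
by apply/polyP => i; rewrite coef_take_poly coef0; case: ltnP => // /A0.
Qed.

Lemma horner_drop_poly0 A (m : nat) : (drop_poly m A).[0] = A`_m.
Proof. by rewrite horner_coef0 coef_drop_poly add0n. Qed.

(** Divide both polynomials by [t ^+ m] and let [t] tend to [0]. *)
Lemma poly_dominated_coef A B c (m : nat) : 0 <= c ->
  (forall t, 0 < t < 1 -> `|A.[t]| <= c * `|B.[t]|) ->
  (forall i, (i < m)%N -> A`_i = 0) -> (forall i, (i < m)%N -> B`_i = 0) ->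
  `|A`_m| <= c * `|B`_m|.
Proof.
move=> c_ge0 AB A0 B0.
rewrite -(horner_drop_poly0 A) -(horner_drop_poly0 B); apply: poly_dominated_at0 => // t t01.
have tm_gt0 : 0 < `|t ^+ m|.
  by case/andP: t01 => t_gt0 _; rewrite normr_gt0 expf_neq0 // gt_eqF.
have := AB t t01; rewrite {1}(poly_low_coef0 A0) {1}(poly_low_coef0 B0).
by rewrite !hornerM hornerXn !normrM mulrA ler_pM2r.
Qed.

Lemma poly_lower_bound A (m : nat) :
  (forall i, (i < m)%N -> A`_i = 0) -> A`_m != 0 ->
  exists eta t0, [/\ 0 < eta, 0 < t0 &
    forall t, 0 < t < t0 -> eta * t ^+ m <= `|A.[t]|].
Proof.
move=> A0 Am0; pose D := drop_poly m A.
have [S S_ge0 DS] := poly_lipschitz0 D.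
have D0_gt0 : 0 < `|D.[0]| by rewrite horner_drop_poly0 normr_gt0.
have den_gt0 : 0 < S + `|D.[0]| by rewrite ltr_wpDl.
(* Below this threshold both [t * S <= |D.[0]| / 2] and [t <= 1] hold, so the Lipschitz bound leaves
   at least half of [|D.[0]|]. *)
exists (`|D.[0]| / 2), (`|D.[0]| / 2 / (S + `|D.[0]|)).
have half_gt0 : 0 < `|D.[0]| / 2 by rewrite divr_gt0.
have t0_gt0 : 0 < `|D.[0]| / 2 / (S + `|D.[0]|) by rewrite divr_gt0.
split=> // t /andP[t_gt0]; rewrite ltr_pdivlMr // mulrDr => tS.
have half_le : `|D.[0]| / 2 <= `|D.[0]| by rewrite ler_pdivrMr // ler_peMr // ler1n.
have tS_le : t * S <= `|D.[0]| / 2.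
  by apply: le_trans (ltW tS); rewrite lerDl mulr_ge0 // ltW.
have t_le1 : t <= 1.
  rewrite -(ler_pM2r D0_gt0) mul1r; apply: le_trans half_le.
  by apply: le_trans (ltW tS); rewrite lerDr mulr_ge0 // ltW.
have nt : `|t| = t by rewrite gtr0_norm.
rewrite (poly_low_coef0 A0) hornerM hornerXn normrM normrX nt.
rewrite ler_wpM2r ?exprn_ge0 ?(ltW t_gt0) //.
have Dt : `|D.[0]| <= `|D.[t]| + `|D.[0]| / 2.
  have {1}-> : D.[0] = D.[t] - (D.[t] - D.[0]) by rewrite opprB addrC subrK.
  apply: le_trans (ler_normB _ _) _; rewrite lerD2l; apply: le_trans tS_le.
  by rewrite -{2}nt DS // nt.
by rewrite -(lerD2r (`|D.[0]| / 2)) -splitr.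
Qed.

(** The bounds [S] are kept apart from [A] so that one estimate serves a whole family of
    polynomials, later all directions in a cone. *)
Lemma poly_upper_bound A (m n : nat) (S : nat -> K) : (size A <= n)%N ->
  (forall i, (i < m)%N -> A`_i = 0) -> (forall i, `|A`_i| <= S i) ->
  forall t, 0 < t <= 1 -> `|A.[t]| <= t ^+ m * \sum_(i < n) S i.
Proof.
move=> sA A0 AS t /andP[t_gt0 t_le1]; rewrite (horner_coef_wide t sA).
apply: le_trans (ler_norm_sum _ _ _) _; rewrite mulr_sumr; apply: ler_sum => i _.
have [im | mi] := ltnP i m.
  rewrite A0 // mul0r normr0 mulr_ge0 ?exprn_ge0 ?(ltW t_gt0) //.
  exact: le_trans (normr_ge0 _) (AS i).
rewrite normrM normrX (gtr0_norm t_gt0) mulrC; apply: ler_pM => //.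
  by rewrite exprn_ge0 // ltW.
by rewrite -(subnK mi) exprD ler_piMl ?exprn_ge0 ?exprn_ile1 ?(ltW t_gt0).
Qed.

(** Induction on the size of [B]: a root of [B] is a root of [A], and the common linear factor can
    be cancelled. *)
Lemma poly_dominated_proportional A B : B != 0 ->
  (forall s, `|A.[s]| <= `|B.[s]|) -> exists c, A = c *: B.
Proof.
have [n] := ubnP (size B); elim: n A B => // n IHn A B sB B0 AB.
have [sB1 | sB1] := leqP (size B) 1.
  have [b Bb] : exists b, B = b%:P by exists B`_0; apply: size1_polyC.
  have b0 : b != 0 by apply: contraNneq B0 => b0; rewrite Bb b0 polyC0.
  have sA : (size A <= 1)%N.
    (* A nonconstant [A] would take the value [2 b]. *)
    rewrite leqNgt; apply/negP => sA.
    have /closed_rootP[s] : size (A - (b *+ 2)%:P) != 1.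
      rewrite size_polyDl ?size_polyN ?neq_ltn ?sA ?orbT //.
      by apply: leq_ltn_trans sA; rewrite size_polyC_leq1.
    rewrite rootE !hornerE subr_eq0 => /eqP As.
    have := AB s; rewrite As Bb hornerC normrMn mulr2n gerDl => b_le0.
    by move: b_le0; rewrite normr_le0 (negPf b0).
  exists (A`_0 / b); rewrite {1}(size1_polyC sA) Bb -mul_polyC -polyCM.
  by rewrite divfK.
have /closed_rootP[r /factor_theorem[B' BE]] : size B != 1 by rewrite neq_ltn sB1 orbT.
have rA : root A r.
  have := AB r; rewrite BE hornerM hornerXsubC subrr mulr0 normr0 normr_le0.
  by rewrite rootE.
have /factor_theorem[A' AE] := rA.
have B'0 : B' != 0 by apply: contraNneq B0 => B'0; rewrite BE B'0 mul0r.
have [|//||c A'c] := IHn A' B'.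
- by move: sB; rewrite BE size_Mmonic ?monicXsubC // size_XsubC addn2 /= ltnS.
- have off s : s != r -> `|A'.[s]| <= `|B'.[s]|.
    move=> sr; have := AB s; rewrite AE BE !hornerM !hornerXsubC !normrM.
    by rewrite ler_pM2r // normr_gt0 subr_eq0.
  move=> s; have [->|/off//] := eqVneq s r.
  (* At the cancelled root the bound is recovered as a limit along [r + t], [t > 0]. *)
  apply: poly_dominated_at => t /andP[t_gt0 _]; apply: off.
  by rewrite -subr_eq0 addrAC subrr add0r gt_eqF.
by exists c; rewrite AE BE A'c scalerAl.
Qed.

End UnivariatePolynomials.

(** * Polynomial functions of several variables and their expansions along lines *)

Section PolynomialFunctions.
Variables (K : numClosedFieldType) (d : nat).
Implicit Types (F : 'rV[K]_d -> K) (u v : 'rV[K]_d) (s t : K).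

(** The inductive form allows bounds and expansions to be built by structural induction rather than
    monomial by monomial. *)
Inductive polyfun : ('rV[K]_d -> K) -> Prop :=
| polyfun_const c : polyfun (fun=> c)
| polyfun_coord j : polyfun (fun v => v 0 j)
| polyfun_add F G : polyfun F -> polyfun G -> polyfun (fun v => F v + G v)
| polyfun_mul F G : polyfun F -> polyfun G -> polyfun (fun v => F v * G v).

Lemma polyfun_sum (I : Type) (r : seq I) (F : I -> 'rV[K]_d -> K) :
  (forall i, polyfun (F i)) -> polyfun (fun v => \sum_(i <- r) F i v).
Proof.
move=> HF; elim: r => [|i r IHr].
  rewrite (_ : (fun _ => _) = fun=> 0); first exact: polyfun_const.
  by apply/funext => v; rewrite big_nil.
rewrite (_ : (fun _ => _) = fun v => F i v + \sum_(j <- r) F j v).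
  exact: polyfun_add.
by apply/funext => v; rewrite big_cons.
Qed.

Lemma polyfun_prod (I : Type) (r : seq I) (F : I -> 'rV[K]_d -> K) :
  (forall i, polyfun (F i)) -> polyfun (fun v => \prod_(i <- r) F i v).
Proof.
move=> HF; elim: r => [|i r IHr].
  rewrite (_ : (fun _ => _) = fun=> 1); first exact: polyfun_const.
  by apply/funext => v; rewrite big_nil.
rewrite (_ : (fun _ => _) = fun v => F i v * \prod_(j <- r) F j v).
  exact: polyfun_mul.
by apply/funext => v; rewrite big_cons.
Qed.

Lemma polyfun_exp F (n : nat) : polyfun F -> polyfun (fun v => F v ^+ n).
Proof.
move=> HF; rewrite (_ : (fun _ => _) = fun v => \prod_(i < n) F v).
  exact: polyfun_prod.
by apply/funext => v; rewrite prodr_const card_ord.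
Qed.

Lemma polyfun_meval (p : mpoly.mpoly d K) :
  polyfun (fun v => mpoly.meval (fun j => v 0 j) p).
Proof.
apply: polyfun_sum => m; apply: polyfun_mul; first exact: polyfun_const.
by apply: polyfun_prod => i; apply/polyfun_exp/polyfun_coord.
Qed.

Lemma polyfun_bounded F r : polyfun F -> 0 <= r ->
  exists2 S, 0 <= S & forall v, (forall j, `|v 0 j| <= r) -> `|F v| <= S.
Proof.
move=> HF r_ge0; elim: HF => [c|j|{}F G _ [S S0 FS] _ [T T0 GT]|{}F G _ [S S0 FS] _ [T T0 GT]].
- by exists `|c|.
- by exists r.
- exists (S + T); first exact: addr_ge0.
  by move=> v vr; apply: le_trans (ler_normD _ _) _; apply: lerD; [apply: FS | apply: GT].
- exists (S * T); first exact: mulr_ge0.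
  by move=> v vr; rewrite normrM; apply: ler_pM => //; [apply: FS | apply: GT].
Qed.

(* [(Phi x v)`_j] is the value at [v] of the degree [j] homogeneous part of
   [F] expanded around [x]. *)
Definition is_expansion F (Phi : 'rV[K]_d -> 'rV[K]_d -> {poly K}) (n : nat) :=
  [/\ forall x v t, (Phi x v).[t] = F (x + t *: v),
      forall x v, (size (Phi x v) <= n)%N,
      forall x j, polyfun (fun v => (Phi x v)`_j)
    & forall x (lam : K) v j, (Phi x (lam *: v))`_j = lam ^+ j * (Phi x v)`_j].

Lemma polyfun_expansion F : polyfun F -> exists Phi n, is_expansion F Phi n.
Proof.
elim=> [c|k|{}F G _ [P [m [PE Pm Pp Ph]]] _ [Q [n [QE Qn Qp Qh]]]
       |{}F G _ [P [m [PE Pm Pp Ph]]] _ [Q [n [QE Qn Qp Qh]]]].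
- exists (fun _ _ => c%:P), 1%N; split=> [x v t|x v|x j|x lam v j].
  + by rewrite hornerC.
  + exact: size_polyC_leq1.
  + exact: polyfun_const.
  + by rewrite coefC; case: j => [|j] /=; rewrite ?expr0 ?mul1r ?mulr0.
- exists (fun x v => (v 0 k) *: 'X + (x 0 k)%:P), 2%N; split=> [x v t|x v|x j|x lam v j].
  + by rewrite !hornerE !mxE addrC mulrC.
  + by rewrite -mul_polyC size_MXaddC; case: ifP => // _; rewrite ltnS size_polyC_leq1.
  + case: j => [|[|j]].
    * rewrite (_ : (fun _ => _) = fun=> x 0 k); first exact: polyfun_const.
      by apply/funext => v; rewrite coefD coefZ coefX coefC mulr0 add0r.
    * rewrite (_ : (fun _ => _) = fun v => v 0 k); first exact: polyfun_coord.
      by apply/funext => v; rewrite coefD coefZ coefX coefC mulr1 addr0.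
    * rewrite (_ : (fun _ => _) = fun=> 0); first exact: polyfun_const.
      by apply/funext => v; rewrite coefD coefZ coefX coefC mulr0 addr0.
  + rewrite !(coefD, coefZ, coefX, coefC) !mxE.
    by case: j => [|[|j]] /=; rewrite ?expr0 ?expr1 ?mulr0 ?mulr1 ?addr0 ?add0r ?mul1r ?mulr0.
- exists (fun x v => P x v + Q x v), (maxn m n); split=> [x v t|x v|x j|x lam v j].
  + by rewrite hornerD PE QE.
  + apply: leq_trans (size_polyD _ _) _; rewrite geq_max !leq_max Pm Qn orbT //.
  + rewrite (_ : (fun _ => _) = fun v => (P x v)`_j + (Q x v)`_j).
      by apply: polyfun_add.
    by apply/funext => v; rewrite coefD.
  + by rewrite !coefD Ph Qh mulrDr.
- exists (fun x v => P x v * Q x v), (m + n)%N; split=> [x v t|x v|x j|x lam v j].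
  + by rewrite hornerM PE QE.
  + apply: leq_trans (size_polyMleq _ _) _; apply: leq_trans (leq_pred _) _.
    by rewrite leq_add.
  + rewrite (_ : (fun _ => _) = fun v => \sum_(i < j.+1) (P x v)`_i * (Q x v)`_(j - i)).
      by apply: polyfun_sum => i; apply: polyfun_mul.
    by apply/funext => v; rewrite coefM.
  + rewrite !coefM mulr_sumr; apply: eq_bigr => i _.
    by rewrite Ph Qh mulrACA -exprD subnKC // -ltnS.
Qed.

(** The exponent is fixed before [u], [v] and [delta]: later the base point and the direction vary
    with [t] while the constant must not. *)
Lemma harnack_polyfun F : polyfun F -> exists n : nat, forall u v delta,
  0 < delta -> (forall s, `|s| < delta -> F (u + s *: v) != 0) ->
  forall s, `|F (u + s *: v)| <= (1 + `|s| / delta) ^+ n * `|F u|.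
Proof.
case/polyfun_expansion => P [n [PE Pn _ _]]; exists n => u v delta delta_gt0 F0 s.
have -> : F u = (P u v).[0] by rewrite PE scale0r addr0.
rewrite -PE mulrC; apply: harnack_poly => // t td.
by rewrite PE F0.
Qed.

End PolynomialFunctions.

Local Open Scope complex_scope.

(** * The upper polyhalfplane and leading homogeneous parts *)

Section UpperHalfPlane.
Variable R : realType.
Implicit Types (a b : Cplx R).

Lemma complexReD a b : complex.Re (a + b) = complex.Re a + complex.Re b.
Proof. by case: a b => [? ?] [? ?]. Qed.

Lemma complexImD a b : complex.Im (a + b) = complex.Im a + complex.Im b.
Proof. by case: a b => [? ?] [? ?]. Qed.

Lemma complexReM a b :
  complex.Re (a * b) = complex.Re a * complex.Re b - complex.Im a * complex.Im b.
Proof. by case: a b => [? ?] [? ?]. Qed.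

Lemma complexImM a b :
  complex.Im (a * b) = complex.Re a * complex.Im b + complex.Im a * complex.Re b.
Proof. by case: a b => [? ?] [? ?]. Qed.

Lemma normCi : `|Complex 0 1 : Cplx R| = 1.
Proof. by rewrite normc_def /= expr0n expr1n add0r sqrtr1. Qed.

Lemma normc_ge_Im a : `|complex.Im a|%:C <= `|a|.
Proof.
(* Multiplication by [-i] turns the imaginary part into the real part. *)
have := normc_ge_Re (a * - (Complex 0 1 : Cplx R)).
by rewrite complexReM /= oppr0 mulr0 sub0r mulrN mulr1 opprK normrM normrN normCi mulr1.
Qed.

Lemma gt0_real_complex a : 0 < a -> exists2 r : R, 0 < r & a = r%:C.
Proof.
by case: a => p q; rewrite ltcE /= => /andP[/eqP-> p0]; exists p.
Qed.

Variable d : nat.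
Local Notation H := (@upper_polyhalfplane R d).
Local Notation X := (@of_real_point R d).
Implicit Types (u v : 'rV[Cplx R]_d) (x y : 'rV[R]_d).

Lemma upper_translate_scale x v (t : Cplx R) : H v -> 0 < t -> H (X x + t *: v).
Proof.
move=> Hv /gt0_real_complex[r r0 ->] j; rewrite !mxE complexImD complexImM /=.
by rewrite add0r mul0r addr0 mulr_gt0.
Qed.

(** Supplies the disc for Harnack's inequality: [|Im (s u_j)| <= |s| r < e <= Im v_j]. *)
Lemma upper_perturb u v (e r s : Cplx R) :
  (forall j, e <= (complex.Im (v 0 j))%:C) -> (forall j, `|u 0 j| <= r) ->
  0 < r -> `|s| < e / r -> H (v + s *: u).
Proof.
move=> ve ur r0; rewrite ltr_pdivlMr // => sr j; rewrite !mxE complexImD.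
have : `|complex.Im (s * u 0 j)|%:C < (complex.Im (v 0 j))%:C.
  apply: le_lt_trans (normc_ge_Im _) _; rewrite normrM.
  apply: le_lt_trans (lt_le_trans sr (ve j)).
  exact: ler_wpM2l.
rewrite ltcR; have := ler_norm (- complex.Im (s * u 0 j)); rewrite normrN.
by move=> ? ?; lra.
Qed.

Lemma upper_Im_lower_bound v : H v ->
  exists2 e : Cplx R, 0 < e & forall j, e <= (complex.Im (v 0 j))%:C.
Proof.
(* The inverse of this sum stands in for a minimum; the summand [1] keeps it positive when
   [d = 0]. *)
move=> Hv; pose S := 1 + \sum_j (complex.Im (v 0 j))^-1.
have S0 : 0 < S by rewrite ltr_pwDl // sumr_ge0 // => j _; rewrite invr_ge0 ltW.
exists (S^-1)%:C => [|j]; first by rewrite ltcR invr_gt0.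
rewrite lecR -[leRHS]invrK lef_pV2 ?posrE ?invr_gt0 //.
rewrite /S (bigD1 j) //= addrCA lerDl addr_ge0 // sumr_ge0 // => k _.
by rewrite invr_ge0 ltW.
Qed.

Lemma row_norm_bound u : exists2 r : Cplx R, 0 < r & forall j, `|u 0 j| <= r.
Proof.
exists (1 + \sum_j `|u 0 j|); first by rewrite ltr_pwDl // sumr_ge0.
by move=> j; rewrite (bigD1 j) //= addrCA lerDl addr_ge0 // sumr_ge0.
Qed.

(* A zero of the leading part at [v] would spread, by Harnack along the line from
   [v] to [w], to every [w]. *)
Lemma leading_part_neq0 (P : 'rV[Cplx R]_d -> Cplx R) Phi (n : nat) x :
  polyfun P -> is_expansion P Phi n -> (forall v, H v -> P v != 0) ->
  exists m : nat, (forall i, (i < m)%N -> forall v, (Phi (X x) v)`_i = 0) /\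
    forall v, H v -> (Phi (X x) v)`_m != 0.
Proof.
move=> HP [PE Pn Pp Ph] P0.
pose occurs i := `[< exists v, (Phi (X x) v)`_i != 0 >].
have [i0 i0P] : exists i, occurs i.
  (* The expansion in direction [(i, ..., i)] is not the zero polynomial, since its value at [t = 1]
     is [P (X x + v)]. *)
  pose v : 'rV[Cplx R]_d := const_mx (Complex 0 1).
  have Hv : H v by move=> j; rewrite mxE /= ltr01.
  exists (size (Phi (X x) v)).-1; apply/asboolP; exists v.
  rewrite -lead_coefE lead_coef_eq0; apply/eqP => Phi0.
  have := P0 _ (upper_translate_scale x Hv ltr01).
  by rewrite -PE Phi0 horner0 eqxx.
case: (ex_minnP (ex_intro _ i0 i0P)) => m /asboolP[w wm] m_min.
have below i v : (i < m)%N -> (Phi (X x) v)`_i = 0.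
  move=> im; apply/eqP; apply: contraTT im => vi; rewrite -leqNgt.
  by apply: m_min; apply/asboolP; exists v.
exists m; split=> [i im v|v Hv]; first exact: below.
apply: contraNneq wm => vm0.
have [N harn] := harnack_polyfun HP.
have [e e0 ve] := upper_Im_lower_bound Hv.
have [r r0 ur] := row_norm_bound (w - v).
(* Harnack constant at [s = 1], from [x + t v] in direction [t (w - v)]: the radius [e / r] is
   independent of [t], hence so is [C]. *)
pose C : Cplx R := (1 + `|1| / (e / r)) ^+ N.
have C0 : 0 <= C.
  by rewrite exprn_ge0 // addr_ge0 // divr_ge0 // divr_ge0 // ltW.
suff : `|(Phi (X x) w)`_m| <= C * `|(Phi (X x) v)`_m|.
  by rewrite vm0 normr0 mulr0 normr_le0.
apply: poly_dominated_coef => // [t /andP[t0 _]|i|i]; try exact: below.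
rewrite !PE.
have := harn (X x + t *: v) (t *: (w - v)) (e / r).
have -> : X x + t *: w = (X x + t *: v) + 1 *: (t *: (w - v)).
  by rewrite scale1r -addrA -scalerDr [v + _]addrC subrK.
apply; first exact: divr_gt0.
move=> s sd; rewrite -addrA scalerA mulrC -scalerA -scalerDr.
apply/P0/upper_translate_scale => //.
exact: upper_perturb ve ur r0 sd.
Qed.

(** Compare lowest coefficients along the ray [x + t v], [t > 0]: by strong induction, each
    vanishing part of [P] below degree [m] forces that of [Q] to vanish. *)
Lemma homogeneous_parts_dominated (P Q : 'rV[Cplx R]_d -> Cplx R) Phi Psi (n n' m : nat) x :
  is_expansion P Phi n -> is_expansion Q Psi n' ->
  (forall v, H v -> `|Q v| <= `|P v|) ->
  (forall i, (i < m)%N -> forall v, (Phi (X x) v)`_i = 0) ->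
  forall v, H v -> (forall i, (i < m)%N -> (Psi (X x) v)`_i = 0) /\
    `|(Psi (X x) v)`_m| <= `|(Phi (X x) v)`_m|.
Proof.
move=> [PE _ _ _] [QE _ _ _] QP Pm v Hv.
have dom t : 0 < t < 1 -> `|(Psi (X x) v).[t]| <= 1 * `|(Phi (X x) v).[t]|.
  case/andP=> t0 _; rewrite mul1r PE QE.
  exact/QP/upper_translate_scale.
have low i : (i < m)%N -> (Psi (X x) v)`_i = 0.
  elim/ltn_ind: i => i IHi im; apply/eqP; rewrite -normr_le0.
  have := @poly_dominated_coef _ _ _ 1 i ler01 dom.
  rewrite Pm // normr0 mulr0; apply=> k ki; last by rewrite Pm // (ltn_trans ki).
  by rewrite IHi // (ltn_trans ki).
split=> //; have := @poly_dominated_coef _ _ _ 1 m ler01 dom low.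
by rewrite mul1r; apply=> i im; apply: Pm.
Qed.

End UpperHalfPlane.

(** * Constancy of a bounded quotient of homogeneous polynomials *)

Section HomogeneousQuotient.
Variables (R : realType) (d m : nat) (F G : 'rV[Cplx R]_d -> Cplx R).
Local Notation H := (@upper_polyhalfplane R d).
Local Notation X := (@of_real_point R d).
Local Notation "''i'" := (Complex 0 1 : Cplx R).
Hypotheses (HF : polyfun F) (HG : polyfun G).
Hypothesis Fhom : forall (lam : Cplx R) v, F (lam *: v) = lam ^+ m * F v.
Hypothesis Ghom : forall (lam : Cplx R) v, G (lam *: v) = lam ^+ m * G v.
Hypothesis F_neq0 : forall v, H v -> F v != 0.
Hypothesis GF : forall v, H v -> `|G v| <= `|F v|.
Implicit Types (a b : 'rV[R]_d).

Lemma upper_imag a b : (forall j, 0 < a 0 j) -> H ('i *: X a + X b).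
Proof.
by move=> a0 j; rewrite !mxE complexImD complexImM /= mul0r add0r mul1r addr0.
Qed.

(* If [Re s <> 0] then [± conj s] moves [i a + s b] into the upper polyhalfplane, so
   homogeneity extends the bound [|G| <= |F|] to the whole complex line. *)
Lemma quotient_const_on_line a b : (forall j, 0 < a 0 j) ->
  G ('i *: X a + X b) / F ('i *: X a + X b) = G ('i *: X a) / F ('i *: X a).
Proof.
move=> a0.
have [Phi [n [PE _ _ _]]] := polyfun_expansion HF.
have [Psi [n' [QE _ _ _]]] := polyfun_expansion HG.
pose A := Psi ('i *: X a) (X b); pose B := Phi ('i *: X a) (X b).
have Hia : H ('i *: X a) by move=> j; rewrite !mxE complexImM /= mul0r add0r mul1r.
have B0 : B.[0] != 0 by rewrite PE scale0r addr0 F_neq0.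
have off s : complex.Re s != 0 -> `|A.[s]| <= `|B.[s]|.
  have rot lam : lam != 0 -> H (lam *: ('i *: X a + s *: X b)) ->
      `|A.[s]| <= `|B.[s]|.
    move=> lam0 /GF; rewrite Fhom Ghom !normrM ler_pM2l -?PE -?QE //.
    by rewrite normr_gt0 expf_neq0.
  case: s rot => p q /= rot p0.
  have ImE (lam : Cplx R) j : complex.Im ((lam *: ('i *: X a + (Complex p q : Cplx R) *: X b)) 0 j)
    = complex.Re lam * (a 0 j + q * b 0 j) + complex.Im lam * (p * b 0 j).
    by rewrite !mxE complexImM complexImD complexReD !complexImM !complexReM /=; ring.
  have [p_gt0 | p_le0] := ltP 0 p.
    apply: (rot (Complex p (- q))).
      by apply/eqP => -[/eqP]; rewrite (negPf p0).
    move=> j; rewrite ImE /=.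
    have -> : p * (a 0 j + q * b 0 j) + - q * (p * b 0 j) = p * a 0 j by ring.
    exact: mulr_gt0.
  have p_lt0 : p < 0 by rewrite lt_neqAle p0.
  apply: (rot (Complex (- p) q)).
    by apply/eqP => -[/eqP]; rewrite oppr_eq0 (negPf p0).
  move=> j; rewrite ImE /=.
  have -> : - p * (a 0 j + q * b 0 j) + q * (p * b 0 j) = - p * a 0 j by ring.
  by rewrite mulr_gt0 // oppr_gt0.
have AB s : `|A.[s]| <= `|B.[s]|.
  have [s0 | /off //] := eqVneq (complex.Re s) 0.
  (* The axis [Re s = 0] is reached as a limit of [s + t], [t > 0]. *)
  apply: poly_dominated_at => t /andP[/gt0_real_complex[r r0 ->] _].
  by apply: off; rewrite complexReD s0 add0r /= gt_eqF.
have [|c Ac] := poly_dominated_proportional _ AB.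
  by apply: contraNneq B0 => ->; rewrite horner0.
have GcF s : G ('i *: X a + s *: X b) = c * F ('i *: X a + s *: X b).
  by rewrite -PE -QE -/A -/B Ac hornerZ.
have := GcF 1; have := GcF 0; rewrite scale1r scale0r addr0 => -> ->.
by rewrite !mulfK ?F_neq0 //; apply: upper_imag.
Qed.

(* Rotation by [1 + i] moves [i a + (1 - a)] to imaginary part [1]. *)
Lemma homogeneous_quotient_const : exists w : Cplx R, forall v, H v -> G v = w * F v.
Proof.
pose one : 'rV[R]_d := const_mx 1.
exists (G ('i *: X one) / F ('i *: X one)) => v Hv.
apply: (mulIf (invr_neq0 (F_neq0 Hv))); rewrite mulfK ?F_neq0 //.
pose a : 'rV[R]_d := \row_j complex.Im (v 0 j).
pose b : 'rV[R]_d := \row_j complex.Re (v 0 j).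
have a0 j : 0 < a 0 j by rewrite mxE.
have one0 j : 0 < one 0 j by rewrite mxE.
have -> : v = 'i *: X a + X b.
  by apply/rowP => j; rewrite !mxE addrC -complexE.
(* The quotient at [v] is moved to [i a + (1 - a)], the one at [(i, ..., i)] to [i + (1 - 2 a)]; the
   latter point is [1 + i] times the former. *)
rewrite (quotient_const_on_line b a0) -(quotient_const_on_line (one - a) a0).
rewrite -(quotient_const_on_line (one - a - a) one0).
have lam0 : (Complex 1 1 : Cplx R) ^+ m != 0.
  by rewrite expf_neq0 //; apply/eqP => -[/eqP]; rewrite oner_eq0.
have -> : 'i *: X one + X (one - a - a) = (Complex 1 1 : Cplx R) *: ('i *: X a + X (one - a)).
  apply/rowP => j; rewrite !mxE; apply/eqP.
  rewrite eq_complex !(complexReD, complexImD, complexReM, complexImM) /=.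
  by apply/andP; split; apply/eqP; ring.
by rewrite Fhom Ghom -mulf_div divff // mul1r.
Qed.

End HomogeneousQuotient.

(** * Estimates in truncated cones *)

Section NontangentialLimit.
Variables (R : realType) (d : nat).
Local Notation H := (@upper_polyhalfplane R d).
Local Notation X := (@of_real_point R d).

(** In the fixed direction [(i, ..., i)] the order of vanishing is exactly [m]; Harnack's inequality
    carries the resulting lower bound to every [v] in the cone, with a constant independent of [v]
    and [t]. *)
Lemma polyfun_lower_bound_cone (P : 'rV[Cplx R]_d -> Cplx R) Phi (n m : nat) x (c : R) :
  polyfun P -> is_expansion P Phi n -> (forall v, H v -> P v != 0) ->
  (forall i, (i < m)%N -> forall v, (Phi (X x) v)`_i = 0) ->
  (forall v, H v -> (Phi (X x) v)`_m != 0) -> 0 < c ->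
  exists S t0 : Cplx R, [/\ 0 <= S, 0 < t0 & forall (v : 'rV[Cplx R]_d) (t : Cplx R),
    (forall j, `|v 0 j| <= c%:C) -> (forall j, c^-1 <= complex.Im (v 0 j)) ->
    0 < t < t0 -> t ^+ m <= S * `|P (X x + t *: v)|].
Proof.
move=> HP [PE _ _ _] P0 Pm Pm0 c0.
pose u : 'rV[Cplx R]_d := const_mx (Complex 0 1).
have Hu : H u by move=> j; rewrite mxE /= ltr01.
have [eta [t0 [eta0 t0_gt0 low]]] :=
  poly_lower_bound (fun i im => Pm i im u) (Pm0 _ Hu).
have [N harn] := harnack_polyfun HP.
(* Since [Im v_j >= 1 / c] and [|u_j - v_j| <= 1 + c], the point [v + s (u - v)] stays in [H] for
   [|s| < delta]. *)
pose delta : Cplx R := (c^-1)%:C / (1 + c%:C).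
have cC0 : 0 < c%:C :> Cplx R by rewrite ltcR.
have den0 : 0 < 1 + c%:C :> Cplx R by rewrite addr_gt0.
have delta0 : 0 < delta by rewrite divr_gt0 // ltcR invr_gt0.
pose C : Cplx R := (1 + `|1| / delta) ^+ N.
have C0 : 0 <= C by rewrite exprn_ge0 // addr_ge0 // divr_ge0 // ltW.
exists (C / eta), t0; split=> //; first by rewrite divr_ge0 // ltW.
move=> v t vc vIm tt0; have /andP[t_gt0 _] := tt0.
rewrite mulrAC ler_pdivlMr // mulrC; apply: le_trans (low t tt0) _; rewrite PE.
have := harn (X x + t *: v) (t *: (u - v)) delta delta0.
have -> : X x + t *: u = (X x + t *: v) + 1 *: (t *: (u - v)).
  by rewrite scale1r -addrA -scalerDr [v + _]addrC subrK.
apply=> s sd; rewrite -addrA scalerA mulrC -scalerA -scalerDr.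
apply/P0/upper_translate_scale => //.
apply: upper_perturb den0 sd => j; first by rewrite lecR.
rewrite !mxE; apply: le_trans (ler_normB _ _) _; rewrite normCi lerD2l.
exact: vc.
Qed.

Lemma quotient_limit_in_cone (P Q : 'rV[Cplx R]_d -> Cplx R) x :
  polyfun P -> polyfun Q -> (forall v, H v -> P v != 0) ->
  (forall v, H v -> `|Q v| <= `|P v|) ->
  exists w : Cplx R, forall c : R, 0 < c ->
  exists S t0 : Cplx R, [/\ 0 <= S, 0 < t0 & forall (v : 'rV[Cplx R]_d) (t : Cplx R),
    (forall j, `|v 0 j| <= c%:C) -> (forall j, c^-1 <= complex.Im (v 0 j)) ->
    0 < t < t0 -> `|Q (X x + t *: v) - w * P (X x + t *: v)| <=
                  t * S * `|P (X x + t *: v)|].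
Proof.
move=> HP HQ P0 QP.
have [Phi [n Pexp]] := polyfun_expansion HP.
have [Psi [n' Qexp]] := polyfun_expansion HQ.
have [m [Pm Pm0]] := leading_part_neq0 x HP Pexp P0.
have Qm := homogeneous_parts_dominated Pexp Qexp QP Pm.
have [PE Pn Pp Ph] := Pexp; have [QE Qn Qp Qh] := Qexp.
have [w Gw] : exists w : Cplx R, forall v, H v ->
    (Psi (X x) v)`_m = w * (Phi (X x) v)`_m.
  apply: (@homogeneous_quotient_const _ _ m) => //.
  by move=> v /Qm[].
exists w => c c0.
have [S [t0 [S0 t0_gt0 low]]] := polyfun_lower_bound_cone HP Pexp P0 Pm Pm0 c0.
pose D v : {poly Cplx R} := Psi (X x) v - w *: Phi (X x) v.
have sD v : (size (D v) <= maxn n' n)%N.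
  rewrite (leq_trans (size_polyD _ _)) // size_polyN geq_max !leq_max Qn /=.
  by apply/orP; right; apply: leq_trans (size_scale_leq _ _) (Pn _ _).
have Dp i : polyfun (fun v => (D v)`_i).
  rewrite (_ : (fun _ => _) = fun v => (Psi (X x) v)`_i + (- w) * (Phi (X x) v)`_i).
    by apply: polyfun_add => //; apply: polyfun_mul => //; apply: polyfun_const.
  by apply/funext => v; rewrite coefB coefZ mulNr.
have c_ge0 : 0 <= c%:C :> Cplx R by rewrite lecR ltW.
(* Each coefficient of [D v] is polynomial in [v], hence bounded uniformly over the cone. *)
have /choice[T DT] : forall i : nat, exists T : Cplx R, 0 <= T /\
    forall v : 'rV[Cplx R]_d, (forall j, `|v 0 j| <= c%:C) -> `|(D v)`_i| <= T.
  by move=> i; have [T T0 DT] := polyfun_bounded (Dp i) c_ge0; exists T.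
(* Below both [t0] and [1]. *)
pose t1 := t0 / (1 + t0).
have den0 : 0 < 1 + t0 by rewrite addr_gt0.
have t1_gt0 : 0 < t1 by rewrite divr_gt0.
have sumT0 : 0 <= \sum_(i < maxn n' n) T i by apply: sumr_ge0 => i _; case: (DT i).
exists ((\sum_(i < maxn n' n) T i) * S), t1; split=> //; first exact: mulr_ge0.
move=> v t vc vIm /andP[t_gt0 tt1].
have Hv : H v by move=> j; apply: lt_le_trans (vIm j); rewrite invr_gt0.
have tt0 : t < t0.
  by apply: lt_trans tt1 _; rewrite ltr_pdivrMr // ltr_pMr // ltrDl.
have t_le1 : t <= 1.
  by apply: ltW; apply: lt_trans tt1 _; rewrite ltr_pdivrMr // mul1r ltrDr.
have -> : Q (X x + t *: v) - w * P (X x + t *: v) = (D v).[t].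
  by rewrite hornerD hornerN hornerZ PE QE.
(* The choice of [w] also cancels degree [m]; this is the source of the extra factor [t]. *)
have Dlow i : (i < m.+1)%N -> (D v)`_i = 0.
  rewrite ltnS leq_eqVlt coefB coefZ => /predU1P[->|im]; first by rewrite Gw // subrr.
  by have [Qlow _] := Qm _ Hv; rewrite (Qlow i im) (Pm i im) mulr0 subrr.
have := poly_upper_bound (sD v) Dlow (fun i => (DT i).2 v vc) (t := t).
rewrite t_gt0 t_le1 => /(_ isT) /le_trans; apply.
rewrite exprS mulrAC mulrA -[leRHS]mulrA; apply: ler_wpM2l.
  by rewrite mulr_ge0 // ltW.
by apply: low; rewrite // t_gt0.
Qed.

End NontangentialLimit.

(** * Passage from the regions [AR c x] to truncated cones *)

Theorem theorem1p4 (R : realType) (d : nat)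
    (f : 'rV[Cplx R]_d -> Cplx R) (hf : rational_schur f) (x : 'rV[R]_d) :
  exists w : Cplx R, is_nontangential_limit f x w.
Proof.
case: hf => -[p [q fpq]] _ f_le1.
case: d f x p q fpq f_le1 => [|d] f x p q fpq f_le1.
  (* For [d = 0] the space is a single point; the general argument takes its scale from coordinate
     [0]. *)
  exists (f 0) => c _ _; apply/cvgrPdist_lt => e e0.
  by near=> z; rewrite [z]thinmx0 subrr normr0.
set H := @upper_polyhalfplane R d.+1.
pose P (z : 'rV[Cplx R]_d.+1) := mpoly.meval (fun j => z 0 j) p.
pose Q (z : 'rV[Cplx R]_d.+1) := mpoly.meval (fun j => z 0 j) q.
have P0 v : H v -> P v != 0 by case/fpq.
have QP v : H v -> `|Q v| <= `|P v|.
  move=> Hv; have := f_le1 v Hv; have [_ ->] := fpq v Hv.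
  by rewrite normrM normfV ler_pdivrMr ?mul1r // normr_gt0 P0.
have [w lim_w] :=
  quotient_limit_in_cone x (polyfun_meval p) (polyfun_meval q) P0 QP.
exists w => c c1 _.
have c0 : 0 < c := lt_le_trans ltr01 c1.
have [S [t0 [S0 t0_gt0 est]]] := lim_w c c0.
apply/cvgrPdist_lt => e e0; rewrite near_withinE.
(* The summand [1] allows [S = 0] and makes [r * S < e] strict. *)
pose r := e / (1 + S).
have S1 : 0 < 1 + S by rewrite ltr_wpDr.
have r0 : 0 < r by rewrite divr_gt0.
near=> z => -[Hz ARz].
(* In [AR c x] every length is comparable to [Im z_0] up to the factor [c], so [(z - x) / t] lies in
   the cone of parameter [c]. *)
pose t : Cplx R := (complex.Im (z 0 0))%:C.
have t_gt0 : 0 < t by rewrite ltcR.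
have t_le : t <= `|z 0 0 - (x 0 0)%:C|.
  apply: le_trans (normc_ge_Im _); rewrite lecR; apply: le_trans (ler_norm _).
  by rewrite complexImD /= oppr0 addr0.
have dist_lt (eps : Cplx R) : ball (of_real_point x) eps z -> t < eps.
  move=> [_ /(_ 0 0)].
  rewrite -ball_normE /= mxE distrC.
  exact: le_lt_trans.
have tr : t < r.
  by apply: dist_lt; near: z; apply: nbhsx_ballx.
have tt0 : t < t0.
  by apply: dist_lt; near: z; apply: nbhsx_ballx.
pose v := t^-1 *: (z - of_real_point x).
have zE : z = of_real_point x + t *: v.
  by rewrite scalerA divff ?gt_eqF // scale1r addrC subrK.
have Im0 : AR_lengths x z (complex.Im (z 0 0)) by right; exists 0.
have tV : t^-1 = ((complex.Im (z 0 0))^-1)%:C by rewrite /t fmorphV.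
have vc j : `|v 0 j| <= c%:C.
  have nj : AR_lengths x z (Normc.normc (z 0 j - (x 0 j)%:C)) by left; exists j.
  have /andP[_] := ARz _ _ nj Im0.
  rewrite -lecR rmorphM /= -tV mulrC => h.
  by rewrite !mxE normrM gtr0_norm // invr_gt0.
have vIm j : c^-1 <= complex.Im (v 0 j).
  have Imj : AR_lengths x z (complex.Im (z 0 j)) by right; exists j.
  have /andP[+ _] := ARz _ _ Imj Im0; rewrite div1r => /le_trans; apply.
  by rewrite !mxE tV complexImM complexImD /= mul0r addr0 oppr0 addr0 mulrC.
have := est v t vc vIm; rewrite t_gt0 tt0 -zE => /(_ isT) est_z.
have [_ fz] := fpq z Hz.
rewrite fz distrC -/(P z) -/(Q z).
have Pz : 0 < `|P z| by rewrite normr_gt0 P0.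
have -> : Q z / P z - w = (Q z - w * P z) / P z by rewrite mulrBl mulfK // P0.
rewrite normrM normfV ltr_pdivrMr //; apply: le_lt_trans est_z _.
rewrite ltr_pM2r //; apply: le_lt_trans (_ : r * S < e).
  by rewrite ler_wpM2r // ltW.
by rewrite /r mulrAC ltr_pdivrMr // ltr_pM2l // ltrDr.
Unshelve. all: by end_near.
Qed.
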